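(* Let $(\lambda,\mu,\nu,b,c)$ be a compatible tower. Then $|\nu|\le|\lambda\cap\mu|$.
   Context: $\mathbb{N}^3$ carries the componentwise partial order. A $3$-dimensional Young diagram is a finite subset $\lambda\subseteq\mathbb{N}^3$ such that $w\in\lambda$ and $v\le w$ imply $v\in\lambda$. A tower is a triple $(\lambda,\nu,b)$ where $\lambda$ is a $3$-dimensional Young diagram, $\nu=(\nu_1,\dots,\nu_r)$ with each $\nu_i=\{(0,0,z): z\in\mathbb{N},\ 0\le z<n_i\}$ for some positive integer $n_i$, and $b=(b_1,\dots,b_r)$ with $b_i\in\mathbb{Z}^3$, such that (a) $\nu_1+b_1,\dots,\nu_r+b_r$ are pairwise disjoint and contained in $\lambda$, and (b) for all $w\in\mathbb{N}^3$ and all $v_i\in\nu_i$ with $v_i+b_i+w\in\lambda$ we have $v_i+w\in\nu_i$. A compatible tower is a tuple $(\lambda,\mu,\nu,b,c)$ such that $(\lambda,\nu,b)$ and $(\mu,\nu,c)$ are both towers (same $\nu$). We write $|\nu|=\sum_{i=1}^r|\nu_i|=\sum_i n_i$. *)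

(* Defs.v *)
From HB Require Import structures.
From mathcomp Require Import all_boot all_order all_algebra.
From mathcomp Require Import finmap.
Set Implicit Arguments. Unset Strict Implicit. Unset Printing Implicit Defensive.
Import Order.TTheory GRing.Theory Num.Theory.

Definition N3 := (nat * nat * nat)%type.
Definition Z3 := (int * int * int)%type.

Definition le3 (v w : N3) : bool :=
  [&& (v.1.1 <= w.1.1)%N, (v.1.2 <= w.1.2)%N & (v.2 <= w.2)%N].

Definition young3 (lam : {fset N3}) : Prop :=
  forall v w : N3, w \in lam -> le3 v w -> v \in lam.

Definition inZ (lam : {fset N3}) (p : Z3) : Prop :=
  exists v : N3, v \in lam /\ p = (Posz v.1.1, Posz v.1.2, Posz v.2).

Definition addNZ (v : N3) (b : Z3) : Z3 :=
  (Posz v.1.1 + b.1.1, Posz v.1.2 + b.1.2, Posz v.2 + b.2)%R.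

Definition addN3 (v w : N3) : N3 := (v.1.1 + w.1.1, v.1.2 + w.1.2, v.2 + w.2)%N.

Definition in_nu (n : nat) (v : N3) : bool :=
  [&& v.1.1 == 0%N, v.1.2 == 0%N & (v.2 < n)%N].

(* (lam, nu, b) is a tower, where nu_i = in_nu (n i), i < r *)
Definition tower (lam : {fset N3}) (r : nat) (n : 'I_r -> nat) (b : 'I_r -> Z3)
  : Prop :=
  young3 lam /\
  (forall i, (0 < n i)%N) /\
  (forall (i j : 'I_r) (v v' : N3), in_nu (n i) v -> in_nu (n j) v' ->
      addNZ v (b i) = addNZ v' (b j) -> i = j) /\
  (forall (i : 'I_r) (v : N3), in_nu (n i) v -> inZ lam (addNZ v (b i))) /\
  (forall (i : 'I_r) (w v : N3), in_nu (n i) v ->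
      inZ lam (addNZ (addN3 v w) (b i)) -> in_nu (n i) (addN3 v w)).

Definition compatible_tower (lam mu : {fset N3}) (r : nat) (n : 'I_r -> nat)
  (b c : 'I_r -> Z3) : Prop :=
  tower lam n b /\ tower mu n c.

(* Main.v *)
Require Import Defs.
From HB Require Import structures.
From mathcomp Require Import all_boot all_order all_algebra.
From mathcomp Require Import finmap.
From mathcomp Require Import zify.
Local Open Scope fset_scope.

Set Implicit Arguments.
Unset Strict Implicit.

(* Let h and g be the column heights of lambda and mu.  The i-th tower fills the
   top of one column p_i of lambda and juts out above both neighbouring columns:
   n_i + max(h(p_i + e_1), h(p_i + e_2)) <= h(p_i), with distinct p_i, and
   likewise for g and columns q_i of mu.  We bound sum n_i by
   I = sum min(h, g) = |lambda :&: mu|, by induction on I.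

   If for each z the slices {h > z} and {g > z} are nested, say the first lies in
   the second, then i |-> p_i injects {i | n_i > z} into {min(h, g) > z}; sum over
   z.  Otherwise the boundaries of two slices cross, and there is a column m in
   both with h(m + e_2) <= z and g(m + e_1) <= z.  If h(m) <= g(m), lower h by one
   along its plateau starting at m in direction e_1: the result is again a Young
   diagram, I drops, and only the tower at the end of the plateau gets shorter,
   by one.  If g(m) < h(m), do the same for g in direction e_2. *)

(** * Finite boxes of columns and the overlap of two height functions *)

Definition box (B : nat) : seq (nat * nat) :=
  [seq (x, y) | x <- iota 0 B, y <- iota 0 B].

Lemma mem_box B x y : ((x, y) \in box B) = (x < B) && (y < B).
Proof.
apply/allpairsP/idP => [[[u v] /= [+ + [-> ->]]]|/andP[xB yB]].
  by rewrite !mem_iota /= !add0n => -> ->.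
by exists (x, y); rewrite /= !mem_iota /= !add0n.
Qed.

Lemma box_uniq B : uniq (box B).
Proof. by apply: allpairs_uniq; rewrite ?iota_uniq // => -[? ?] [? ?]. Qed.

Definition overlap B (h g : nat -> nat -> nat) : nat :=
  \sum_(c <- box B) minn (h c.1 c.2) (g c.1 c.2).

(** Reflection in the diagonal turns lowering in direction e_1 into lowering in direction e_2. *)
Definition transp (h : nat -> nat -> nat) : nat -> nat -> nat := fun x y => h y x.

Lemma overlapC B h g : overlap B h g = overlap B g h.
Proof. by apply: eq_bigr => c _; rewrite minnC. Qed.

Lemma overlap_transp B h g : overlap B (transp h) (transp g) = overlap B h g.
Proof.
rewrite /overlap /transp.
have swap_inj : injective (fun c : nat * nat => (c.2, c.1)).
  by move=> [? ?] [? ?] [-> ->].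
have boxT : perm_eq (box B) [seq (c.2, c.1) | c <- box B].
  apply: uniq_perm; rewrite ?map_inj_uniq ?box_uniq // => -[x y].
  rewrite mem_box; apply/idP/mapP => [/andP[xB yB]|[[u v] + [-> ->]]].
    by exists (y, x); rewrite // mem_box yB.
  by rewrite mem_box andbC.
by rewrite [RHS](perm_big _ boxT) big_map.
Qed.

(** At [(x, y)] the minimum is [h x y], so that term drops strictly; no other term grows. *)
Lemma overlap_lt B h h' g x y :
    (forall u v, h' u v <= h u v) -> x < B -> y < B ->
    h' x y < h x y <= g x y ->
  overlap B h' g < overlap B h g.
Proof.
move=> le_h' xB yB /andP[lt_h' le_hg].
have cB : (x, y) \in box B by rewrite mem_box xB.
rewrite /overlap !(perm_big _ (perm_to_rem cB)) !big_cons /=.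
rewrite -addSn; apply: leq_add; first by lia.
by apply: leq_sum => c _; have := le_h' c.1 c.2; lia.
Qed.

Lemma sum_ltn M k : \sum_(z < M) (z < k) = minn k M.
Proof.
elim: M => [|M IHM]; first by rewrite big_ord0 minn0.
by rewrite big_ord_recr /= IHM; lia.
Qed.

(* [h] holds the column heights of a Young diagram, [p i] is the column of the
   i-th tower.  Lengths [n i = 0] are allowed, so that a tower can be shortened
   without changing the index set. *)
Record terraced (B : nat) (T : finType) (n : T -> nat)
    (h : nat -> nat -> nat) (p : T -> nat * nat) : Prop := Terraced {
  terraced_x : forall x y, h x.+1 y <= h x y;
  terraced_y : forall x y, h x y.+1 <= h x y;
  terraced_box : forall x y, 0 < h x y -> (x < B) && (y < B);
  terraced_inj : injective p;
  terraced_dropx : forall i, n i + h (p i).1.+1 (p i).2 <= h (p i).1 (p i).2;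
  terraced_dropy : forall i, n i + h (p i).1 (p i).2.+1 <= h (p i).1 (p i).2 }.

(** * Terraced height functions *)

Section Terraced.
Variables (B : nat) (T : finType).
Implicit Types (n : T -> nat) (h g : nat -> nat -> nat) (p q : T -> nat * nat).

Lemma terraced_transp n h p : terraced B n h p ->
  terraced B n (transp h) (fun i => ((p i).2, (p i).1)).
Proof.
case=> hx hy hB pI dx dy; rewrite /transp.
split => //= [x y /hB|i j [e2 e1]]; first by rewrite andbC.
by apply: pI; rewrite [p i]surjective_pairing e1 e2 -surjective_pairing.
Qed.

Lemma terraced_mono n h p : terraced B n h p ->
  forall x y u v, x <= u -> y <= v -> h u v <= h x y.
Proof.
case=> hx hy _ _ _ _ x y u v /subnKC <- /subnKC <-.
elim: (u - x) => [|d IHd]; last by rewrite addnS (leq_trans (hx _ _)).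
rewrite addn0; elim: (v - y) => [|d IHd]; first by rewrite addn0.
by rewrite addnS (leq_trans (hy _ _)).
Qed.

Lemma terraced_shorten n n' h p : (forall i, n' i <= n i) ->
  terraced B n h p -> terraced B n' h p.
Proof.
move=> le_n [hx hy hB pI dx dy]; split=> // i.
  by rewrite (leq_trans _ (dx i)) ?leq_add2r.
by rewrite (leq_trans _ (dy i)) ?leq_add2r.
Qed.

Lemma terraced_row_end n h p x y z : terraced B n h p -> z < h x y ->
  exists2 u, x <= u & z < h u y /\ h u.+1 y <= z.
Proof.
move=> th hz.
have ex : exists u, (x <= u) && (z < h u y) by exists x; rewrite leqnn.
have ub u : (x <= u) && (z < h u y) -> u <= B.
  by case/andP=> _ /(leq_trans (ltn0Sn z)) /(terraced_box th)/andP[/ltnW].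
case: (ex_maxnP ex ub) => u /andP[xu zu] umax; exists u => //; split=> //.
rewrite leqNgt; apply/negP => zu1.
by have := umax u.+1; rewrite zu1 (leqW xu) ltnn => /(_ isT).
Qed.

(** * Nested slices *)

Lemma sum_le_overlap_nested n h g p q :
    terraced B n h p -> terraced B n g q ->
    (forall z, (forall x y, z < h x y -> z < g x y) \/
               (forall x y, z < g x y -> z < h x y)) ->
  \sum_i n i <= overlap B h g.
Proof.
move=> th tg nested; pose M := \sum_i n i.
have level k p0 z : terraced B n k p0 ->
    (forall x y, z < k x y -> z < minn (h x y) (g x y)) ->
  \sum_i (z < n i) <= \sum_(c <- box B) (z < minn (h c.1 c.2) (g c.1 c.2)).
  move=> tk sub; rewrite -big_mkcond -[X in _ <= X]big_mkcond /=.
  rewrite -big_filter -[X in _ <= X]big_filter !sum1_size.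
  rewrite -(size_map p0); apply: uniq_leq_size => [|c].
    rewrite map_inj_uniq; last exact: terraced_inj tk.
    by rewrite filter_uniq ?index_enum_uniq.
  case/mapP=> i; rewrite mem_filter => /andP[zn _] ->.
  have zk : z < k (p0 i).1 (p0 i).2.
    by apply: leq_trans zn (leq_trans (leq_addr _ _) (terraced_dropx tk i)).
  rewrite mem_filter sub //= [p0 i]surjective_pairing mem_box.
  by apply: (terraced_box tk); lia.
(* [M] bounds every [n i], so the levels below [M] count each length in full. *)
have -> : \sum_i n i = \sum_(z < M) \sum_i (z < n i).
  rewrite exchange_big; apply: eq_bigr => i _; rewrite sum_ltn.
  by apply/esym/minn_idPl; rewrite /M (bigD1 i) //= leq_addr.
apply: (@leq_trans (\sum_(z < M)
    \sum_(c <- box B) (z < minn (h c.1 c.2) (g c.1 c.2)))).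
  apply: leq_sum => z _; case: (nested z) => sub.
    by apply: level th _ => x y zh; rewrite leq_min zh sub.
  by apply: level tg _ => x y zg; rewrite leq_min zg sub.
rewrite exchange_big; apply: leq_sum => c _.
by rewrite sum_ltn geq_minl.
Qed.

(* Lowering [h] by one along the plateau starting at [(x, y)] in the row [y]
   only shortens the tower, if any, at the far end of that plateau. *)
Lemma terraced_lower n h g p q x y :
    terraced B n h p -> terraced B n g q ->
    h x y.+1 < h x y <= g x y ->
  exists n' h', [/\ terraced B n' h' p, terraced B n' g q,
    \sum_i n i <= (\sum_i n' i).+1 & overlap B h' g < overlap B h g].
Proof.
move=> th tg /andP[hy1 hg]; pose k := (h x y).-1.
have hk : h x y = k.+1 by rewrite /k; lia.
have [e xe [ke ke1]] : exists2 u, x <= u & k < h u y /\ h u.+1 y <= k.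
  by apply: terraced_row_end th _; rewrite hk.
(* Beyond [e] heights are at most [k], so the minimum changes only the columns from [x] to [e]. *)
pose h' u v := if (v == y) && (x <= u) then minn (h u v) k else h u v.
pose n' i := n i - (p i == (e, y)).
have le_h' u v : h' u v <= h u v by rewrite /h'; case: ifP => // _; lia.
have mono := terraced_mono th.
exists n', h'; split.
- split.
  + move=> u v; rewrite /h'; have := terraced_x th u v.
    by case: eqP => [->|//] /=; case: (leqP x u); case: (leqP x u.+1); lia.
  + move=> u v; rewrite /h'; have := terraced_y th u v.
    have [->|] := eqVneq v y.
      (* The strict drop from [h x y] to [h x y.+1] keeps row [y.+1] within [k] from [x] on. *)
      rewrite (gtn_eqF (ltnSn y)) /=; case: (leqP x u) => // xu.
      by have := mono x y.+1 u y.+1 xu (leqnn _); lia.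
    by move=> _ /=; case: ifP => // _; lia.
  + by move=> u v h'0; apply: (terraced_box th); apply: leq_trans (le_h' u v).
  + exact: terraced_inj th.
  + move=> i; have := terraced_dropx th i; rewrite /n' /h'.
    case: (p i) => u v /=; rewrite xpair_eqE.
    have [->|] := eqVneq v y; last by rewrite andbF subn0.
    rewrite andbT /=; case: (leqP x u) => [xu|ux]; last first.
      have -> : (u == e) = false by lia.
      by rewrite subn0; case: ifP; lia.
    rewrite (leqW xu) /=.
    have hu : h u y <= k.+1 by rewrite -hk mono.
    have [eu|ue] := eqVneq u e; first by subst u; lia.
    (* Before [e] the next column is equally high, which forces [n i = 0]. *)
    case: (ltnP u e) => [lt_ue|lt_eu]; first by have := mono u.+1 y e y lt_ue; lia.
    by have := mono e.+1 y u y; lia.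
  (* The drop in direction e_1 is used here too: it gives length zero inside the plateau. *)
  + move=> i; have := terraced_dropy th i; have := terraced_dropx th i.
    rewrite /n' /h'; case: (p i) => u v /=; rewrite xpair_eqE.
    have [->|vy] := eqVneq v y; last first.
      by rewrite andbF subn0 /=; case: ifP => _; lia.
    rewrite andbT (gtn_eqF (ltnSn y)) /=; case: (leqP x u) => [xu|ux]; last by lia.
    have hu : h u y <= k.+1 by rewrite -hk mono.
    have hu1 : h u y.+1 <= k by have := mono x y.+1 u y.+1 xu (leqnn _); lia.
    have [eu|ue] := eqVneq u e; first by subst u; lia.
    case: (ltnP u e) => [lt_ue|lt_eu]; first by have := mono u.+1 y e y lt_ue; lia.
    by have := mono e.+1 y u y; lia.
- by apply: terraced_shorten tg => i; apply: leq_subr.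
- have le1 : \sum_i (p i == (e, y)) <= 1.
    have [i /eqP pi|none] := pickP (fun i => p i == (e, y)); last first.
      by rewrite big1 // => i _; rewrite none.
    rewrite (bigD1 i) //= big1 ?addn0 ?leq_b1 // => j ji.
    by rewrite -pi (inj_eq (terraced_inj th)) (negPf ji).
  apply: leq_trans (_ : \sum_i (n' i + (p i == (e, y))) <= _).
    by apply: leq_sum => i _; rewrite /n'; lia.
  by rewrite big_split /= -[X in _ <= X]addn1 leq_add2l.
- have /andP[xB yB] : (x < B) && (y < B) by apply: (terraced_box th); lia.
  apply: overlap_lt le_h' xB yB _.
  by rewrite hg andbT /h' eqxx leqnn hk /=; lia.
Qed.

(** * Crossing slices and the induction on the overlap *)

(** In row [ay] the slice of [g] lies inside that of [h]; in row [b_y] it does not. Take the last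
    row [y] below [b_y] where it does, and the end [x] of the slice of [g] in that row. *)
Lemma terraced_crossing n h g p q z ax ay bx b_y :
    terraced B n h p -> terraced B n g q ->
    g ax ay <= z < h ax ay -> h bx b_y <= z < g bx b_y -> ay < b_y ->
  exists x y, [/\ z < h x y, z < g x y, h x y.+1 <= z & g x.+1 y <= z].
Proof.
move=> th tg /andP[ga ha] /andP[hb gb] ab.
have hm := terraced_mono th; have gm := terraced_mono tg.
pose R y := all (fun x => (z < g x y) ==> (z < h x y)) (iota 0 B).
have RP y : reflect (forall x, z < g x y -> z < h x y) (R y).
  apply: (iffP allP) => H x; last by move=> _; apply/implyP/H.
  move=> zg; apply: (implyP (H x _)) => //; rewrite mem_iota /=.
  by case/andP: (terraced_box tg (leq_ltn_trans (leq0n z) zg)).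
have exR : exists y, (y < b_y) && R y.
  exists ay; rewrite ab; apply/RP => x zg.
  have xa : x < ax by rewrite ltnNge; apply/negP => /gm/(_ (leqnn ay)); lia.
  by apply: leq_trans ha (hm _ _ _ _ (ltnW xa) (leqnn _)).
have ubR y : (y < b_y) && R y -> y <= b_y by case/andP=> /ltnW.
case: (ex_maxnP exR ubR) => y /andP[yb /RP Ry] ymax.
(* Inclusion fails in row [y.+1]: by maximality of [y], or at [bx] if that row is [b_y]. *)
have [u gu hu] : exists2 u, z < g u y.+1 & h u y.+1 <= z.
  have [eb|nb] := eqVneq y.+1 b_y; first by exists bx; rewrite eb.
  have : ~~ R y.+1.
    apply/negP => Ry1; have y1b : y.+1 < b_y by lia.
    by have := ymax y.+1; rewrite Ry1 y1b ltnn => /(_ isT).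
  case/allPn => u _; rewrite negb_imply -leqNgt => /andP[gu hu].
  by exists u.
have [x ux [gx gx1]] := terraced_row_end tg (leq_trans gu (terraced_y tg u y)).
exists x, y; split=> //; first exact: Ry.
exact: leq_trans (hm _ _ _ _ ux (leqnn _)) hu.
Qed.

(** If [g x y < h x y], the new pair comes back exchanged and reflected, which does not affect the
    overlap; hence the existential form. *)
Lemma terraced_step n h g p q z x y :
    terraced B n h p -> terraced B n g q ->
    z < h x y -> z < g x y -> h x y.+1 <= z -> g x.+1 y <= z ->
  exists n' h' g' p' q', [/\ terraced B n' h' p', terraced B n' g' q',
    \sum_i n i <= (\sum_i n' i).+1 & overlap B h' g' < overlap B h g].
Proof.
move=> th tg zh zg h1 g1; case: (leqP (h x y) (g x y)) => [hg|gh].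
  have [|n' [h' [th' tg' le lt]]] := @terraced_lower n h g p q x y th tg; first by lia.
  by exists n', h', g, p, q.
have := @terraced_lower _ _ _ _ _ y x (terraced_transp tg) (terraced_transp th).
rewrite /transp => /(_ _)[|n' [g' [tg' th' le lt]]]; first by lia.
exists n', g', (transp h), (fun i => ((q i).2, (q i).1)),
  (fun i => ((p i).2, (p i).1)).
by split=> //; rewrite -[X in _ < X]overlap_transp [X in _ < X]overlapC.
Qed.

(** A step costs the sum at most one and the overlap at least one, so it would turn a counterexample
    into a smaller one. Hence no slices cross, and all are nested. *)
Lemma sum_le_overlap n h g p q : terraced B n h p -> terraced B n g q ->
  \sum_i n i <= overlap B h g.
Proof.
have [s] := ubnP (overlap B h g).
elim: s n h g p q => // s IHs n h g p q le_s th tg.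
rewrite leqNgt; apply/negP => lt_W.
have no_crossing z x y :
    z < h x y -> z < g x y -> h x y.+1 <= z -> g x.+1 y <= z -> False.
  move=> zh zg h1 g1.
  have [n' [h' [g' [p' [q' [th' tg' le lt]]]]]] :=
    terraced_step th tg zh zg h1 g1.
  by have := IHs _ _ _ _ _ (leq_trans lt le_s) th' tg'; lia.
have no_crossing' z x y :
    z < h x y -> z < g x y -> g x y.+1 <= z -> h x.+1 y <= z -> False.
  move=> zh zg g1 h1.
  have [n' [h' [g' [p' [q' [th' tg' le lt]]]]]] :=
    terraced_step tg th zg zh g1 h1.
  rewrite [X in _ < X]overlapC in lt.
  by have := IHs _ _ _ _ _ (leq_trans lt le_s) th' tg'; lia.
suff : \sum_i n i <= overlap B h g by rewrite leqNgt lt_W.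
apply: (sum_le_overlap_nested th tg) => z.
(* Slices lie in the box, so inclusion is decidable and its failure yields a witness. *)
pose sub k l := all (fun c => (z < k c.1 c.2) ==> (z < l c.1 c.2)) (box B).
have subP k l p0 : terraced B n k p0 ->
    reflect (forall x y, z < k x y -> z < l x y) (sub k l).
  move=> tk; apply: (iffP allP) => H; last by move=> [x y] _; apply/implyP/H.
  move=> x y zk; apply: (implyP (H (x, y) _)) => //; rewrite mem_box.
  by apply: (terraced_box tk); lia.
case: (subP h g p th) => [|/(subP h g p th)]; first by left.
case: (subP g h q tg) => [|/(subP g h q tg)]; first by right.
case/allPn=> -[bx b_y] _; rewrite negb_imply -leqNgt /= => /andP[gb hb].
case/allPn=> -[ax ay] _; rewrite negb_imply -leqNgt /= => /andP[ha ga].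
case: (ltngtP ay b_y) => [ab|ba|ab].
- have [||x [y [? ? ? ?]]] := @terraced_crossing n h g p q z ax ay bx b_y th tg _ _ ab.
  + by rewrite ga.
  + by rewrite hb.
  by case: (no_crossing z x y).
- have [||x [y [? ? ? ?]]] := @terraced_crossing n g h q p z bx b_y ax ay tg th _ _ ba.
  + by rewrite hb.
  + by rewrite ga.
  by case: (no_crossing' z x y).
(* Within one row both slices are initial segments, hence comparable. *)
subst b_y; exfalso; case: (leqP ax bx) => [|/ltnW] le_x.
  by have := terraced_mono tg le_x (leqnn ay); lia.
by have := terraced_mono th le_x (leqnn ay); lia.
Qed.

End Terraced.

(** * From towers to terraced heights *)

Lemma fset_N3_bounded (A : {fset N3}) :
  exists B, forall x y z, (x, y, z) \in A -> [&& x < B, y < B & z < B].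
Proof.
exists (\sum_(v <- enum_fset A) (v.1.1 + v.1.2 + v.2)).+1 => x y z vA.
by rewrite (big_rem (x, y, z)) //=; lia.
Qed.

Lemma young3_heights (lam : {fset N3}) : young3 lam ->
  exists h, forall x y z, ((x, y, z) \in lam) = (z < h x y).
Proof.
move=> young; have [B lamB] := fset_N3_bounded lam.
(* The height is the first missing [z]; [find] returns [B] if none below [B] is missing. *)
exists (fun x y => find (fun z => (x, y, z) \notin lam) (iota 0 B)) => x y z.
set h := find _ _; have hB : h <= B by rewrite -(size_iota 0 B) find_size.
apply/idP/idP => [zlam|zh]; last first.
  by have /negbFE := before_find 0 zh; rewrite nth_iota // (leq_trans zh).
rewrite ltnNge; apply/negP => hz.
have zB : z < B by case/and3P: (lamB _ _ _ zlam).
have hltB : h < B by apply: leq_ltn_trans zB.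
have : has (fun z => (x, y, z) \notin lam) (iota 0 B).
  by rewrite has_find size_iota.
move/(nth_find 0); rewrite nth_iota // add0n => /negP; apply.
by apply: young zlam _; rewrite /le3 /= !leqnn.
Qed.

Lemma inZE (lam : {fset N3}) x y z :
  inZ lam (Posz x, Posz y, Posz z) <-> (x, y, z) \in lam.
Proof.
split=> [[[[u v] w] [lam_v /= [-> -> ->]]]|lam_v] //.
by exists (x, y, z).
Qed.

Lemma addNZE v x y z : addNZ v (Posz x, Posz y, Posz z) =
  (Posz (v.1.1 + x), Posz (v.1.2 + y), Posz (v.2 + z)).
Proof. by rewrite /addNZ !PoszD. Qed.

(** Since [n i > 0], the cell [b i] itself lies in [lam], so its coordinates are nonnegative. *)
Lemma tower_corner (lam : {fset N3}) r (n : 'I_r -> nat) b : tower lam n b ->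
  exists (p : 'I_r -> nat * nat) (s : 'I_r -> nat),
    forall i, b i = (Posz (p i).1, Posz (p i).2, Posz (s i)).
Proof.
case=> _ [n_gt0 [_ [sub _]]].
exists (fun i => (absz (b i).1.1, absz (b i).1.2)), (fun i => absz (b i).2) => i.
have [|[[u v] w] [_ /=]] := sub i (0, 0, 0); first by rewrite /in_nu /= n_gt0.
by case: (b i) => [[b1 b2] b3]; rewrite /addNZ /= !GRing.add0r => -[-> -> ->].
Qed.

(** Containment and condition (b) make column [p i] exactly [n i + s i] high and its two successors
    at most [s i] high. *)
Lemma tower_terraced (lam : {fset N3}) r (n : 'I_r -> nat) b B h :
    tower lam n b -> (forall x y z, ((x, y, z) \in lam) = (z < h x y)) ->
    (forall x y z, (x, y, z) \in lam -> [&& x < B, y < B & z < B]) ->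
  exists p, terraced B n h p.
Proof.
move=> tow lamE lamB; have [p [s bE]] := tower_corner tow.
case: tow => young [n_gt0 [disj [sub top]]].
have antimono x y u v : x <= u -> y <= v -> h u v <= h x y.
  move=> xu yv; case hE: (h u v) => [//|k].
  by rewrite -lamE (young _ (u, v, k)) ?lamE ?hE // /le3 /= xu yv leqnn.
have in_lam i k : k < n i -> (k + s i < h (p i).1 (p i).2)%N.
  move=> kn; have := sub i (0, 0, k); rewrite bE addNZE /= !add0n inZE lamE.
  by apply; rewrite /in_nu /= kn.
have out_lam i (x y k : nat) : (x, y, k) != (0, 0, k) \/ n i <= k ->
    (h (x + (p i).1) (y + (p i).2) <= k + s i)%N.
  move=> xyk; rewrite leqNgt -lamE; apply/negP => /inZE inlam.
  (* Condition (b) is applied to the bottom cell of the tower, shifted by [(x, y, k)]. *)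
  have := top i (x, y, k) (0, 0, 0).
  rewrite bE addNZE /addN3 /= !add0n => /(_ _ inlam).
  rewrite /in_nu /= n_gt0 => /(_ isT) /and3P[/eqP x0 /eqP y0 kn].
  by case: xyk; [rewrite x0 y0 eqxx | rewrite leqNgt kn].
have heightE i : h (p i).1 (p i).2 = (n i + s i)%N.
  have := out_lam i 0 0 (n i) (or_intror (leqnn _)).
  by have := in_lam i (n i).-1; have := n_gt0 i; rewrite !add0n; lia.
exists p; split=> [x y|x y|x y|i j pij|i|i].
- exact: antimono.
- exact: antimono.
- by rewrite -lamE => /lamB/and3P[-> ->].
- have := heightE i; rewrite pij heightE => eq_top.
  have := n_gt0 i; have := n_gt0 j => nj ni.
  (* Two towers in one column would share its top cell. *)
  apply: (disj i j (0, 0, (n i).-1) (0, 0, (n j).-1)).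
  + by rewrite /in_nu /=; lia.
  + by rewrite /in_nu /=; lia.
  + by rewrite !bE !addNZE pij /=; congr (_, Posz _); lia.
- by have := out_lam i 1 0 0 (or_introl isT); rewrite heightE !add0n add1n; lia.
- by have := out_lam i 0 1 0 (or_introl isT); rewrite heightE !add0n add1n; lia.
Qed.

(** Stacking [m c] cells on each column of the box lists distinct cells of the intersection. *)
Lemma overlap_le_card (lam mu : {fset N3}) B h g :
    (forall x y z, ((x, y, z) \in lam) = (z < h x y)) ->
    (forall x y z, ((x, y, z) \in mu) = (z < g x y)) ->
  overlap B h g <= #|` lam `&` mu|.
Proof.
move=> lamE muE; pose m c := minn (h c.1 c.2) (g c.1 c.2).
pose cells := [seq (c, z) | c <- box B, z <- iota 0 (m c)].
have -> : overlap B h g = size cells.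
  rewrite size_allpairs_dep /overlap sumnE big_map.
  by apply: eq_bigr => c _; rewrite size_iota.
apply: uniq_leq_size => [|_ /allpairsPdep[[x y] [z [_ + ->]]]].
  apply: allpairs_uniq_dep => [|c _|]; rewrite ?box_uniq ?iota_uniq //.
  by move=> [c z] [c' z'] _ _ /= [-> ->].
by rewrite mem_iota in_fsetI lamE muE -leq_min.
Qed.

Theorem theorem2p1 (lam mu : {fset N3}) (r : nat) (n : 'I_r -> nat)
  (b c : 'I_r -> Z3) :
  compatible_tower lam mu n b c ->
  (\sum_(i < r) n i <= #|` lam `&` mu |)%N.
Proof.
case=> tow_lam tow_mu.
have [h hE] := young3_heights (proj1 tow_lam).
have [g gE] := young3_heights (proj1 tow_mu).
have [B bounded] := fset_N3_bounded (lam `|` mu).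
have [|p th] := tower_terraced (B := B) tow_lam hE.
  by move=> x y z v_lam; apply: bounded; rewrite in_fsetU v_lam.
have [|q tg] := tower_terraced (B := B) tow_mu gE.
  by move=> x y z v_mu; apply: bounded; rewrite in_fsetU v_mu orbT.
exact: leq_trans (sum_le_overlap th tg) (overlap_le_card B hE gE).
Qed.
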